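(* Let $\mathbf S$ be a flip-swap language of binary strings of length $n$ that includes the string $0^n$, with $|\mathbf S|>1$. For every $\alpha\in\mathbf S$, the string $f(\alpha)$ is the string immediately following $\alpha$ in the cyclic ordering $\mathcal{BRGC}(\mathbf S)$, where $f$ is defined by (the first applicable case being used) $$f(\alpha)=\begin{cases} 0^n & \text{if }\alpha=0^{n-1}1;\\ flip_\alpha(t_\alpha) & \text{if } w(\alpha)\text{ is even and }(t_\alpha=1\text{ or }flip2_\alpha(t_\alpha-1,t_\alpha)\notin\mathbf S);\\ flip2_\alpha(t_\alpha-1,t_\alpha) & \text{if } w(\alpha)\text{ is even, } t_\alpha>1 \text{ and }flip2_\alpha(t_\alpha-1,t_\alpha)\in\mathbf S;\\ flip2_\alpha(\ell_\alpha,\ell_\alpha+1) & \text{if } w(\alpha)\text{ is odd and }flip_\alpha(\ell_\alpha+1)\notin\mathbf S;\\ flip_\alpha(\ell_\alpha+1) & \text{if } w(\alpha)\text{ is odd and }flip_\alpha(\ell_\alpha+1)\in\mathbf S. \end{cases}$$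
   Context: A flip-swap language (with respect to $1$) is a set $\mathbf S$ of binary strings of length $n$ such that $\mathbf S\cup\{0^n\}$ is closed under the following two operations, whenever applicable: (1) flip (complement) the leftmost $1$; (2) swap the leftmost $1$ with the bit immediately to its right (applicable when the leftmost $1$ exists and is not in the last position). For $\alpha=b_1b_2\cdots b_n$: $w(\alpha)$ is the number of $1$s; $flip_\alpha(i)$ is the string obtained by complementing $b_i$; $flip2_\alpha(i,j)$ is the string obtained by complementing both $b_i$ and $b_j$; $\ell_\alpha$ is the position of the leftmost $1$ of $\alpha$ (or $n+1$ if there is none); $t_\alpha$ is the leftmost position such that $flip_\alpha(t_\alpha)\in\mathbf S$ (it exists when $|\mathbf S|>1$). BRGC order on binary strings of length $n$ is the order of the listing $BRGC(n)$ defined recursively by $BRGC(1)=0,1$ and, for $n>1$, $BRGC(n)=BRGC(n-1)\cdot 0,\ \overline{BRGC}(n-1)\cdot 1$, where $\overline{BRGC}(m)$ is $BRGC(m)$ in reverse order and $\mathcal L\cdot x$ is the listing $\mathcal L$ with $x$ appended to the end of each string. $\mathcal{BRGC}(\mathbf S)$ is the listing of the elements of $\mathbf S$ in the relative order of $BRGC(n)$, regarded cyclically (the first string follows the last). *)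

(* Defs.v *)
From mathcomp Require Import all_boot.

Set Implicit Arguments.
Unset Strict Implicit.
Unset Printing Implicit Defensive.

(* A binary string b_1 b_2 ... b_n is an n.-tuple bool (true is the bit 1).
   Positions are natural numbers counted from 1: the element k : 'I_n of the
   underlying index type is position k.+1, and position n+1 is out of range. *)

Section Strings.

Variable n : nat.
Implicit Types (a : n.-tuple bool) (S : {set n.-tuple bool}) (i j : nat).

Definition zeros : n.-tuple bool := nseq_tuple n false.

(* 0^{n-1} 1 (for n >= 1) *)
Definition zeros1 : n.-tuple bool := [tuple k.+1 == n | k < n].

Definition weight a : nat := count_mem true a.

Definition flip a i : n.-tuple bool :=
  [tuple if k.+1 == i then ~~ tnth a k else tnth a k | k < n].

Definition flip2 a i j : n.-tuple bool :=
  [tuple if (k.+1 == i) || (k.+1 == j) then ~~ tnth a k else tnth a k | k < n].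

Definition bit a i : bool := nth false a i.-1.

Definition swap a i j : n.-tuple bool :=
  [tuple if k.+1 == i then bit a j
         else if k.+1 == j then bit a i else tnth a k | k < n].

(* [index] returns n when there is no 1, so that [ell a] is then n+1. *)
Definition ell a : nat := (index true a).+1.

(* The leftmost i in 1..n with flip a i \in S (n+1 if there is none). *)
Definition tpos S a : nat := (find (fun i => flip a i \in S) (iota 1 n)).+1.

Definition flip_swap_language S : Prop :=
  forall a, a \in zeros |: S ->
    (true \in a -> flip a (ell a) \in zeros |: S) /\
    (true \in a -> ell a < n -> swap a (ell a) (ell a).+1 \in zeros |: S).

Definition succ_rule S a : n.-tuple bool :=
  let t := tpos S a in
  let l := ell a in
  if a == zeros1 then zeros
  else if ~~ odd (weight a) then
    if (t == 1) || (flip2 a t.-1 t \notin S) then flip a t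
    else flip2 a t.-1 t
  else
    if flip a l.+1 \notin S then flip2 a l l.+1
    else flip a l.+1.

End Strings.

(* The recursion is started at length 0 with the empty string; its value at
   length 1 is then the listing 0, 1. *)
Fixpoint BRGC (n : nat) : seq (n.-tuple bool) :=
  match n with
  | 0 => [:: [tuple]]
  | m.+1 => [seq rcons_tuple u false | u <- BRGC m]
            ++ [seq rcons_tuple u true | u <- rev (BRGC m)]
  end.

Definition BRGC_listing (n : nat) (S : {set n.-tuple bool}) :
  seq (n.-tuple bool) := [seq a <- BRGC n | a \in S].

(* Main.v *)
(* Split S by the last bit into S_0 and S_1.  Both are again flip-swap
   languages, and the listing of S is that of S_0 followed by the reversal of
   that of S_1.  Appending a 1 changes the parity of the weight and reversing
   exchanges successors and predecessors, so the induction must prove that the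
   odd rule and the even rule of f, exchanged, also compute predecessors.  At
   the junction the two neighbours are the last strings of the listings of S_0
   and S_1, and a nonzero flip-swap language always ends with 0^{n-1}1. *)
Require Import Defs.
From mathcomp Require Import all_boot.

Set Implicit Arguments.
Unset Strict Implicit.
Unset Printing Implicit Defensive.

(** * Bitwise description of the operations on strings *)

Lemma eq_tuple_nth n (a b : n.-tuple bool) :
  (forall k, k < n -> nth false a k = nth false b k) -> a = b.
Proof. by move=> eq_ab; apply: eq_from_tnth => k; rewrite !(tnth_nth false) eq_ab. Qed.

Lemma nth_mktuple_lt n (F : 'I_n -> bool) k (lt_kn : k < n) :
  nth false [tuple F i | i < n] k = F (Ordinal lt_kn).
Proof. by rewrite -[k in LHS]/(val (Ordinal lt_kn)) nth_mktuple. Qed.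

Lemma nth_flip n (a : n.-tuple bool) i k : k < n ->
  nth false (flip a i) k = (k.+1 == i) (+) nth false a k.
Proof.
by move=> lt_kn; rewrite nth_mktuple_lt (tnth_nth false) /=; case: eqP.
Qed.

Lemma nth_flip2 n (a : n.-tuple bool) i j k : k < n ->
  nth false (flip2 a i j) k = ((k.+1 == i) || (k.+1 == j)) (+) nth false a k.
Proof.
by move=> lt_kn; rewrite nth_mktuple_lt (tnth_nth false) /=; case: (_ || _).
Qed.

Lemma nth_swap n (a : n.-tuple bool) i j k : k < n ->
  nth false (swap a i j) k =
    if k.+1 == i then bit a j else if k.+1 == j then bit a i else nth false a k.
Proof. by move=> lt_kn; rewrite nth_mktuple_lt (tnth_nth false). Qed.

Lemma nth_zeros1 n k : k < n -> nth false (zeros1 n) k = (k.+1 == n).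
Proof. by move=> lt_kn; rewrite nth_mktuple_lt. Qed.

Lemma nth_zeros n k : nth false (zeros n) k = false.
Proof. by rewrite nth_nseq if_same. Qed.

Lemma flip_default n (a : n.-tuple bool) i : n < i -> flip a i = a.
Proof.
move=> lt_ni; apply: eq_tuple_nth => k lt_kn; rewrite nth_flip //.
by rewrite (ltn_eqF (leq_ltn_trans lt_kn lt_ni)).
Qed.

Lemma flip_neq n (a : n.-tuple bool) i : 0 < i <= n -> flip a i != a.
Proof.
case: i => // i lt_in; apply/eqP => /(congr1 (fun b : n.-tuple bool => nth false b i)).
by rewrite nth_flip // eqxx; case: (nth _ _ _).
Qed.

Lemma flip_zeros_last n : flip (zeros n) n = zeros1 n.
Proof.
by apply: eq_tuple_nth => k lt_kn; rewrite nth_flip // nth_zeros1 // nth_zeros addbF.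
Qed.

Lemma flip_zeros1_last n : flip (zeros1 n) n = zeros n.
Proof.
by apply: eq_tuple_nth => k lt_kn; rewrite nth_flip // nth_zeros1 // nth_zeros addbb.
Qed.

(** * Appending a last bit *)

Lemma rcons_tuple_eq n (u v : n.-tuple bool) c d :
  (rcons_tuple u c == rcons_tuple v d) = (u == v) && (c == d).
Proof. exact: eqseq_rcons. Qed.

Lemma rcons_tupleP n (a : n.+1.-tuple bool) :
  exists (u : n.-tuple bool) c, a = rcons_tuple u c.
Proof.
exists [tuple nth false a k | k < n], (nth false a n).
apply: eq_tuple_nth => k; rewrite ltnS leq_eqVlt nth_rcons size_tuple.
by case: ltngtP => // [lt_kn _ | -> _] //; rewrite nth_mktuple_lt.
Qed.

Section RconsTuple.

Variables (n : nat) (u : n.-tuple bool) (c : bool).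

Lemma nth_rcons_tuple k :
  nth false (rcons_tuple u c) k =
    if k < n then nth false u k else if k == n then c else false.
Proof. by rewrite nth_rcons size_tuple. Qed.

Lemma zeros_rcons : zeros n.+1 = rcons_tuple (zeros n) false.
Proof.
by apply: eq_tuple_nth => k _; rewrite nth_zeros nth_rcons nth_zeros !if_same.
Qed.

Lemma zeros1_rcons : zeros1 n.+1 = rcons_tuple (zeros n) true.
Proof.
apply: eq_tuple_nth => k le_kn; rewrite nth_zeros1 // nth_rcons size_tuple nth_zeros.
by rewrite eqSS; case: ltngtP.
Qed.

Lemma flip_rcons i : i <= n ->
  flip (rcons_tuple u c) i = rcons_tuple (flip u i) c.
Proof.
move=> le_in; apply: eq_tuple_nth => k lt_kn; rewrite nth_flip //.
rewrite nth_rcons_tuple nth_rcons size_tuple; case: (ltngtP k n) => [lt|lt|->].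
- by rewrite nth_flip.
- by rewrite ltnS leqNgt lt in lt_kn.
- by rewrite (gtn_eqF (_ : i < n.+1)).
Qed.

Lemma flip_rcons_last :
  flip (rcons_tuple u c) n.+1 = rcons_tuple u (~~ c).
Proof.
apply: eq_tuple_nth => k lt_kn; rewrite nth_flip // eqSS.
by rewrite nth_rcons_tuple nth_rcons size_tuple; case: (ltngtP k n).
Qed.

Lemma flip2_rcons i j : i <= n -> j <= n ->
  flip2 (rcons_tuple u c) i j = rcons_tuple (flip2 u i j) c.
Proof.
move=> le_in le_jn; apply: eq_tuple_nth => k; rewrite ltnS => le_kn.
rewrite nth_flip2 // nth_rcons_tuple nth_rcons size_tuple.
case: (ltngtP k n) le_kn => // [lt|-> _]; first by rewrite nth_flip2.
by rewrite (gtn_eqF (_ : i < n.+1)) // (gtn_eqF (_ : j < n.+1)).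
Qed.

Lemma flip2_rcons_last i : i <= n ->
  flip2 (rcons_tuple u c) i n.+1 = rcons_tuple (flip u i) (~~ c).
Proof.
move=> le_in; apply: eq_tuple_nth => k; rewrite ltnS => le_kn.
rewrite nth_flip2 // nth_rcons_tuple nth_rcons size_tuple eqSS.
case: (ltngtP k n) le_kn => // [lt|-> _]; first by rewrite nth_flip // orbF.
by rewrite orbT.
Qed.

Lemma bit_rcons i : 0 < i <= n -> bit (rcons_tuple u c) i = bit u i.
Proof. by case: i => // i /= lt_in; rewrite /bit nth_rcons_tuple lt_in. Qed.

Lemma swap_rcons i j : 0 < i <= n -> 0 < j <= n ->
  swap (rcons_tuple u c) i j = rcons_tuple (swap u i j) c.
Proof.
move=> /[dup] i_n /andP[_ le_in] /[dup] j_n /andP[_ le_jn].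
apply: eq_tuple_nth => k; rewrite ltnS => le_kn.
rewrite nth_swap // !bit_rcons // nth_rcons_tuple nth_rcons size_tuple.
case: (ltngtP k n) le_kn => // [lt|-> _]; first by rewrite nth_swap.
by rewrite (gtn_eqF (_ : i < n.+1)) // (gtn_eqF (_ : j < n.+1)).
Qed.

Lemma swap_rcons_last : 0 < n ->
  swap (rcons_tuple (zeros1 n) false) n n.+1 = zeros1 n.+1.
Proof.
move=> n_gt0; apply: eq_tuple_nth => k; rewrite ltnS => le_kn.
rewrite nth_swap // nth_zeros1 // nth_rcons size_tuple /bit !nth_rcons size_tuple /=.
rewrite ltnn eqxx prednK // leqnn nth_zeros1 ?prednK // eqxx eqSS.
case: (ltngtP k n) le_kn => // [lt _|-> _]; last by rewrite gtn_eqF.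
by case: eqP => // ne; rewrite nth_zeros1 //; apply/eqP.
Qed.

Lemma ell_rcons : true \in u -> ell (rcons_tuple u c) = ell u.
Proof. by move=> u1; rewrite /ell /= -cats1 index_cat u1. Qed.

Lemma weight_rcons : weight (rcons_tuple u c) = weight u + c.
Proof. by rewrite /weight /= -cats1 count_cat /= addn0; case: c. Qed.

End RconsTuple.

Lemma ell_le n (a : n.-tuple bool) : (ell a <= n) = (true \in a).
Proof. by rewrite -index_mem size_tuple. Qed.

Lemma true_in_zeros n : (true \in zeros n) = false.
Proof. by rewrite mem_nseq andbF. Qed.

Lemma ell_zeros1 n : ell (zeros1 n.+1) = n.+1.
Proof.
by rewrite zeros1_rcons /ell /= -cats1 index_cat true_in_zeros size_nseq addn0.
Qed.

Lemma weight_zeros n : weight (zeros n) = 0.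
Proof. by apply/count_memPn; rewrite true_in_zeros. Qed.

Lemma weight_zeros1 n : weight (zeros1 n.+1) = 1.
Proof. by rewrite zeros1_rcons weight_rcons weight_zeros. Qed.

Lemma zeros1_eq_zeros n : (zeros1 n.+1 == zeros n.+1) = false.
Proof. by rewrite zeros1_rcons zeros_rcons rcons_tuple_eq andbF. Qed.

(** * Splitting a flip-swap language into S_0 and S_1 *)

Definition last_bit n (S : {set n.+1.-tuple bool}) c : {set n.-tuple bool} :=
  [set u | rcons_tuple u c \in S].

(** If [u] contains a 1, the leftmost 1 of [u] followed by [c] lies in [u], so a flip or swap there
    commutes with appending [c]. *)
Lemma flip_swap_last_bit n (S : {set n.+1.-tuple bool}) c :
  flip_swap_language S -> flip_swap_language (last_bit S c).
Proof.
move=> hS u; rewrite in_setU1 => /predU1P[->|]; first by rewrite true_in_zeros.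
rewrite inE => uS; have := hS (rcons_tuple u c).
rewrite in_setU1 uS orbT => /(_ isT) [hflip hswap].
(* A result equal to 0^{n+1} has prefix 0^n, so the adjoined zero string is respected when the last
   bit is dropped. *)
have lift v : rcons_tuple v c \in zeros n.+1 |: S -> v \in zeros n |: last_bit S c.
  by rewrite !in_setU1 inE zeros_rcons rcons_tuple_eq; case: eqP.
have uc1 : true \in u -> true \in rcons_tuple u c.
  by move=> u1; rewrite mem_rcons inE u1 orbT.
split=> [u1 | u1 lt_ln]; apply: lift.
  by rewrite -flip_rcons ?ell_le // -(ell_rcons c u1) hflip ?uc1.
rewrite -swap_rcons //; last exact: ltnW.
by rewrite -(ell_rcons c u1) hswap ?uc1 // (ell_rcons c u1) ltnW.
Qed.

(** Induction on the length. If the prefix is nonzero, 0^{n-1}1c lies in S by induction; for c = 1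
    flip its leftmost 1, for c = 0 swap it to the right, and 0^n 1 results either way. *)
Lemma zeros1_mem n (S : {set n.-tuple bool}) (a : n.-tuple bool) :
  flip_swap_language S -> a \in S -> a != zeros n -> zeros1 n \in S.
Proof.
elim: n S a => [|n IHn] S a hS aS; first by rewrite [a]tuple0 [zeros 0]tuple0 eqxx.
have [u [c def_a]] := rcons_tupleP a; rewrite {a}def_a in aS *.
rewrite zeros_rcons rcons_tuple_eq.
have [u0|u_neq0 _] := eqVneq u (zeros n).
  by case: c aS => //; rewrite u0 -zeros1_rcons.
have eS : rcons_tuple (zeros1 n) c \in S.
  have := IHn (last_bit S c) u (flip_swap_last_bit hS) _ u_neq0.
  by rewrite !inE => /(_ aS).
case: n => [|n] in S hS IHn u c aS u_neq0 eS *.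
  by rewrite [u]tuple0 [zeros 0]tuple0 eqxx in u_neq0.
have e1 : true \in zeros1 n.+1 by rewrite zeros1_rcons mem_rcons inE eqxx.
have ec1 : true \in rcons_tuple (zeros1 n.+1) c by rewrite mem_rcons inE e1 orbT.
have := hS (rcons_tuple (zeros1 n.+1) c).
rewrite in_setU1 eS orbT ec1 (ell_rcons _ e1) ell_zeros1 => /(_ isT) [/(_ isT)].
rewrite flip_rcons // flip_zeros1_last => hflip /(_ isT (ltnSn _)).
case: c hflip {aS eS ec1} => [hflip _ | _].
  by move: hflip; rewrite -zeros1_rcons in_setU1 zeros1_eq_zeros.
by rewrite swap_rcons_last // in_setU1 zeros1_eq_zeros.
Qed.

(** * The even and odd rules under appending a bit *)

(** The rule f without its first case, and with the parity of the weight replaced by a free Boolean,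
    so that the exchanged rules can be applied too. *)
Definition gray_step n (S : {set n.-tuple bool}) (odd_rule : bool) (a : n.-tuple bool) :=
  let t := tpos S a in
  let l := ell a in
  if ~~ odd_rule then
    if (t == 1) || (flip2 a t.-1 t \notin S) then flip a t
    else flip2 a t.-1 t
  else
    if flip a l.+1 \notin S then flip2 a l l.+1
    else flip a l.+1.

Lemma gray_step_even n (S : {set n.-tuple bool}) a (t := tpos S a) :
  gray_step S false a =
    if (t == 1) || (flip2 a t.-1 t \notin S) then flip a t else flip2 a t.-1 t.
Proof. by []. Qed.

Lemma gray_step_odd n (S : {set n.-tuple bool}) a (l := ell a) :
  gray_step S true a =
    if flip a l.+1 \notin S then flip2 a l l.+1 else flip a l.+1.
Proof. by []. Qed.

Lemma tpos_le n (S : {set n.-tuple bool}) a :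
  (tpos S a <= n) = has (fun i => flip a i \in S) (iota 1 n).
Proof. by rewrite has_find size_iota. Qed.

Lemma tpos_gt n (S : {set n.-tuple bool}) a : n < tpos S a -> tpos S a = n.+1.
Proof.
rewrite ltnNge tpos_le => /hasNfind; rewrite /tpos => ->; by rewrite size_iota.
Qed.

(** Flips inside the prefix are tested first and depend only on S_c. Only if all fail is the last
    bit tested, at position n+1; n+2 is the default of a failed search. *)
Lemma tpos_rcons n (S : {set n.+1.-tuple bool}) (u : n.-tuple bool) c :
  tpos S (rcons_tuple u c) =
    if tpos (last_bit S c) u <= n then tpos (last_bit S c) u
    else if u \in last_bit S (~~ c) then n.+1 else n.+2.
Proof.
have eq_mem : {in iota 1 n, (fun i => flip (rcons_tuple u c) i \in S) =1
                            (fun i => flip u i \in last_bit S c)}.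
  by move=> i; rewrite mem_iota add1n ltnS => /andP[_ le_in]; rewrite inE flip_rcons.
have iota_rcons : iota 1 n.+1 = iota 1 n ++ [:: n.+1] by rewrite -[in LHS](addn1 n) iotaD.
rewrite tpos_le {1}/tpos iota_rcons find_cat (eq_in_has eq_mem).
rewrite (eq_in_find eq_mem); case: ifP => // _.
by rewrite size_iota /= flip_rcons_last inE; case: ifP; rewrite ?addn0 ?addn1.
Qed.

(* Out-of-range positions make [gray_step] the identity, so the hypothesis
   that [u] moves is what excludes them. *)
Lemma gray_step_rcons n (S : {set n.+1.-tuple bool}) p (u : n.-tuple bool) c :
  u \in last_bit S c -> gray_step (last_bit S c) p u != u ->
  gray_step S p (rcons_tuple u c) = rcons_tuple (gray_step (last_bit S c) p u) c.
Proof.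
move=> uS; case: p; rewrite !(gray_step_even, gray_step_odd).
  have [le_ln|] := leqP (ell u).+1 n; last first.
    by move=> /flip_default ->; rewrite uS eqxx.
  have u1 : true \in u by rewrite -ell_le ltnW.
  rewrite ell_rcons // flip_rcons // (flip2_rcons _ _ (ltnW le_ln)) // inE.
  by case: ifP.
have [le_tn _|gt_tn] := leqP (tpos (last_bit S c) u) n; last first.
  rewrite (tpos_gt gt_tn) succnK.
  (* Position n+1 is out of range, so only bit n changes. Were the result in S_c, the search for
     [tpos] would have succeeded at n or earlier. *)
  have -> : flip2 u n n.+1 = flip u n.
    by apply: eq_tuple_nth => k lt_kn; rewrite nth_flip2 // nth_flip //
      eqSS (ltn_eqF lt_kn) orbF.
  rewrite (flip_default _ (ltnSn n)); case: ifP => [_|/norP[n_gt0 /negPn fS]].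
    by rewrite eqxx.
  have : tpos (last_bit S c) u <= n.
    by rewrite tpos_le; apply/hasP; exists n => //;
      rewrite mem_iota lt0n add1n ltnS leqnn andbT.
  by rewrite leqNgt gt_tn.
rewrite tpos_rcons le_tn flip_rcons // flip2_rcons ?(leq_trans (leq_pred _)) //.
by rewrite inE; case: ifP.
Qed.

(** The last string of the listing when S is a flip-swap language containing 0^n: by [zeros1_mem],
    the second case means S = {0^n}. *)
Definition last_gray n (S : {set n.-tuple bool}) :=
  if zeros1 n \in S then zeros1 n else zeros n.

(** The junction, crossed in either direction according to [c]. From 0^{n-1}1 the odd rule has l =
    n; from 0^n, the only element of S_c, the even rule has t = n+1. Both complement bit n+1, and
    bit n as well exactly when this is needed to reach the last string on the other side. *)
Lemma gray_step_last n (S : {set n.+1.-tuple bool}) c :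
    flip_swap_language S ->
    zeros n \in last_bit S c -> zeros n \in last_bit S (~~ c) ->
  gray_step S (odd (weight (last_gray (last_bit S c))))
      (rcons_tuple (last_gray (last_bit S c)) c) =
    rcons_tuple (last_gray (last_bit S (~~ c))) (~~ c).
Proof.
move=> hS zc znc; rewrite {1 2}/last_gray; case: ifPn => [e_in|e_notin].
  (* For n = 0 the prefix is empty and has weight 0, so the even rule applies, with t = 1. *)
  case: n S hS zc znc e_in => [|n] S hS zc znc e_in.
    rewrite [zeros1 0]tuple0 [last_gray _]tuple0 gray_step_even tpos_rcons.
    by move: znc; rewrite [zeros 0]tuple0 => ->; rewrite /= flip_rcons_last.
  rewrite weight_zeros1 gray_step_odd ell_rcons; last by rewrite -ell_le ell_zeros1.
  rewrite ell_zeros1 flip_rcons_last flip2_rcons_last // flip_zeros1_last.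
  by rewrite /last_gray inE; case: (_ \in S).
have z_only u : u \in last_bit S c -> u = zeros n.
  by move=> uS; apply: contraNeq e_notin => /(zeros1_mem (flip_swap_last_bit hS) uS).
have t_gt : n < tpos (last_bit S c) (zeros n).
  rewrite ltnNge tpos_le; apply/hasPn => i; rewrite mem_iota add1n ltnS => i_n.
  by apply/negP => /z_only /eqP; rewrite (negPf (flip_neq _ i_n)).
rewrite weight_zeros gray_step_even tpos_rcons leqNgt t_gt znc succnK.
rewrite flip2_rcons_last // flip_rcons_last flip_zeros_last eqSS /last_gray inE.
case: n {S hS zc znc e_notin z_only t_gt} => [|n] in S hS zc znc e_notin z_only t_gt *.
  by rewrite [zeros1 0]tuple0 [zeros 0]tuple0 if_same.
by case: (_ \in S).
Qed.

(* Toggling [p] amounts both to reversing the listing (gray_adj_sym) and to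
   stripping a final 1 from the strings (gray_adj_rcons). *)
Definition gray_adj n (S : {set n.-tuple bool}) p : rel (n.-tuple bool) :=
  fun a b => [&& a != b, gray_step S (p (+) odd (weight a)) a == b
                       & gray_step S (~~ p (+) odd (weight b)) b == a].

Lemma gray_adj_sym n (S : {set n.-tuple bool}) p a b :
  gray_adj S p a b = gray_adj S (~~ p) b a.
Proof. by rewrite /gray_adj negbK eq_sym [X in _ && X]andbC. Qed.

Lemma gray_adj_rcons n (S : {set n.+1.-tuple bool}) p c u v :
    u \in last_bit S c -> v \in last_bit S c ->
  gray_adj (last_bit S c) (p (+) c) u v ->
  gray_adj S p (rcons_tuple u c) (rcons_tuple v c).
Proof.
move=> uS vS /and3P[neq_uv /eqP step_u /eqP]; rewrite -addNb => step_v.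
have parity q w : q (+) odd (weight (rcons_tuple w c)) = q (+) c (+) odd (weight w).
  by rewrite weight_rcons oddD oddb addbAC addbA.
rewrite /gray_adj rcons_tuple_eq eqxx andbT neq_uv !parity.
(* The inequality in [gray_adj] supplies the hypothesis of [gray_step_rcons] that the string
   moves. *)
by rewrite !gray_step_rcons ?step_u ?step_v ?eqxx // eq_sym.
Qed.

(** * The listing as a path for the rule *)

Lemma BRGC_listing_rcons n (S : {set n.+1.-tuple bool}) :
  BRGC_listing S =
    [seq rcons_tuple u false | u <- BRGC_listing (last_bit S false)] ++
    [seq rcons_tuple u true | u <- rev (BRGC_listing (last_bit S true))].
Proof.
rewrite /BRGC_listing /= filter_cat !filter_map -filter_rev.
by congr (_ ++ _); congr map; apply: eq_filter => u; rewrite /= inE.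
Qed.

Lemma mem_BRGC n (a : n.-tuple bool) : a \in BRGC n.
Proof.
elim: n a => [|n IHn] a; first by rewrite [a]tuple0 inE.
have [u [c ->]] := rcons_tupleP a; rewrite mem_cat; apply/orP.
by case: c; [right | left]; apply: map_f; rewrite ?mem_rev.
Qed.

Lemma mem_BRGC_listing n (S : {set n.-tuple bool}) : BRGC_listing S =i S.
Proof. by move=> a; rewrite mem_filter mem_BRGC andbT. Qed.

Lemma sorted_map_rcons n (S : {set n.+1.-tuple bool}) p c s :
    {subset s <= last_bit S c} -> sorted (gray_adj (last_bit S c) (p (+) c)) s ->
  sorted (gray_adj S p) [seq rcons_tuple u c | u <- s].
Proof.
move=> sS; rewrite sorted_map; apply: (sub_in_sorted (P := mem (last_bit S c)));
  last exact/allP.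
by move=> u v; apply: gray_adj_rcons.
Qed.

(** Both ends are recorded for the induction: the last strings of the two halves meet at the
    junction, and the first string 0^n of the listing of S_1 becomes, after reversal, the final 0^n
    1. *)
Lemma BRGC_listing_path n (S : {set n.-tuple bool}) :
    flip_swap_language S -> zeros n \in S ->
  exists s, [/\ BRGC_listing S = zeros n :: s,
                path (gray_adj S false) (zeros n) s & last (zeros n) s = last_gray S].
Proof.
elim: n S => [|n IHn] S hS zS.
  exists [::]; split; rewrite // ?[last_gray S]tuple0 ?[zeros 0]tuple0 //.
  by rewrite [zeros 0]tuple0 in zS; rewrite /BRGC_listing /= zS.
have hSc c := flip_swap_last_bit (c := c) hS.
have z0 : zeros n \in last_bit S false by rewrite inE -zeros_rcons.
have [s0 [def0 path0 last0]] := IHn _ (hSc false) z0.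
have sub c : {subset BRGC_listing (last_bit S c) <= last_bit S c}.
  by move=> u; rewrite mem_BRGC_listing.
have srt0 : sorted (gray_adj S false) [seq rcons_tuple u false | u <- zeros n :: s0].
  by rewrite -def0; apply: sorted_map_rcons; [exact: sub | rewrite def0].
(* Either S = {0^{n+1}} and S_1 is empty, or S_1 contains 0^n and the induction hypothesis applies
   to it. *)
have [e_in|e_notin] := boolP (zeros1 n.+1 \in S); last first.
  have z_only u : u \in S -> u = zeros n.+1.
    by move=> uS; apply: contraNeq e_notin => /(zeros1_mem hS uS).
  have empty1 : BRGC_listing (last_bit S true) = [::].
    case E : (BRGC_listing _) (sub true) => [|u s] // /(_ u (mem_head _ _)).
    rewrite inE => /z_only/eqP; by rewrite zeros_rcons rcons_tuple_eq andbF.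
  exists [seq rcons_tuple u false | u <- s0]; split.
  - by rewrite BRGC_listing_rcons empty1 def0 cats0 zeros_rcons.
  - by rewrite zeros_rcons.
  - rewrite /last_gray (negPf e_notin); apply: z_only.
    rewrite zeros_rcons (last_map (fun u => rcons_tuple u false)) last0.
    by rewrite /last_gray inE; case: ifP => // _; rewrite -zeros_rcons.
have z1 : zeros n \in last_bit S true by rewrite inE -zeros1_rcons.
have [s1 [def1 path1 last1]] := IHn _ (hSc true) z1.
have srt1 : sorted (gray_adj S false) [seq rcons_tuple u true | u <- rev (zeros n :: s1)].
  apply: sorted_map_rcons => [u|]; first by rewrite mem_rev -def1; apply: sub.
  (* The final 1 toggles the parameter of [gray_adj], and the reversal toggles it back. *)
  rewrite rev_sorted /=; apply: sub_path path1 => u v.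
  by rewrite gray_adj_sym.
exists ([seq rcons_tuple u false | u <- s0] ++
        [seq rcons_tuple u true | u <- rev (zeros n :: s1)]).
split.
- by rewrite BRGC_listing_rcons def0 def1 zeros_rcons.
- rewrite zeros_rcons cat_path; apply/andP; split; first exact: srt0.
  rewrite (last_map (fun u => rcons_tuple u false)) last0 lastI rev_rcons last1 /=.
  rewrite lastI rev_rcons last1 /= in srt1.
  rewrite srt1 andbT /gray_adj rcons_tuple_eq andbF /= !weight_rcons addn0 oddD /= addbT.
  (* The successor across the junction is the case c = 0, the predecessor the case c = 1. *)
  by rewrite negbK (gray_step_last hS z0 z1) (gray_step_last hS z1 z0) !eqxx.
- by rewrite last_cat rev_cons map_rcons last_rcons /last_gray e_in zeros1_rcons.
Qed.

Theorem theorem4 (n : nat) (S : {set n.-tuple bool})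
    (hS : flip_swap_language S) (h0 : zeros n \in S) (hcard : 1 < #|S|)
    (a : n.-tuple bool) (ha : a \in S) :
  next (BRGC_listing S) a = succ_rule S a.
Proof.
have [s [def_L path_s last_s]] := BRGC_listing_path hS h0.
have eS : zeros1 n \in S.
  have [b] : exists2 b, b \in S & b != zeros n.
    have [x [y [xS yS neq_xy]]] := card_gt1P hcard.
    have [x0|x_neq0] := eqVneq x (zeros n); last by exists x.
    by exists y; rewrite // eq_sym -x0.
  exact: zeros1_mem.
suff cyc : cycle (fun b c => c == succ_rule S b) (BRGC_listing S).
  by apply/eqP/(next_cycle cyc); rewrite mem_BRGC_listing.
(* The closing step, from 0^{n-1}1 back to 0^n, is the first case of f; the path supplies all the
   others. *)
rewrite def_L /= rcons_path last_s /last_gray eS /succ_rule eqxx eqxx andbT.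
apply: sub_path path_s => b c /and3P[neq_bc /eqP step_b _].
(* The first case cannot occur inside the path: at 0^{n-1}1 the odd rule would flip an out-of-range
   position and fix the string, whereas adjacent strings differ. *)
have [def_b|_] := eqVneq b; last by rewrite -step_b.
case: n => [|n] in S hS h0 hcard a ha s def_L last_s eS b c neq_bc step_b def_b *.
  by rewrite [b]tuple0 [c]tuple0 eqxx in neq_bc.
move: step_b neq_bc; rewrite def_b weight_zeros1 /gray_step /= ell_zeros1.
by rewrite flip_default // eS /= => <-; rewrite eqxx.
Qed.
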